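(* For every integer $c\ge 0$ there is a polynomial-time algorithm that, given a $c$-inductive graph $G$ and a positive integer $k$, outputs subsets $V_1,\dots,V_k$ of the vertex set of $G$ such that every edge of $G$ has both endpoints in some $V_i$ and $\max_i|V_i|\le (c+1)\cdot\mathrm{OPT}(G,k)$, where $\mathrm{OPT}(G,k)$ is the optimum value of $\textsc{Cover}(G,k)$. (That is, $\textsc{Cover}$ admits an approximation algorithm with approximation ratio $c+1$ on $c$-inductive graphs.)
   Context: A graph $G$ is $c$-inductive (also called $c$-degenerate) if every subgraph of $G$ has a vertex of degree at most $c$; equivalently, $G$ has a vertex $u$ of degree at most $c$ such that $G\setminus u$ is $c$-inductive, the empty graph being $c$-inductive. For a graph $G=(V,E)$ and integer $k\ge1$, $\textsc{Cover}(G,k)$ is the problem of choosing subsets $V_1,\dots,V_k\subseteq V$ such that every edge of $G$ has both endpoints in some $V_i$, minimizing $\max_i|V_i|$; $\mathrm{OPT}(G,k)$ denotes this minimum. *)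

(* Defs.v *)
From HB Require Import structures.
From mathcomp Require Import all_boot all_order all_algebra.

Set Implicit Arguments.
Unset Strict Implicit.
Unset Printing Implicit Defensive.

Definition simple_graph (T : finType) (e : rel T) : Prop :=
  symmetric e /\ irreflexive e.

(* (W, f) is a subgraph of the graph (T, e): any set W of vertices, with any
   set f of edges of e joining vertices of W; not necessarily induced. *)
Definition subgraph (T : finType) (e : rel T) (W : {set T}) (f : rel T) : Prop :=
  [/\ symmetric f, subrel f e &
      forall x y, f x y -> (x \in W) && (y \in W)].

(* The subgraph with no vertex is excluded, as it has no vertex at all. *)
Definition inductive_graph (T : finType) (c : nat) (e : rel T) : Prop :=
  forall (W : {set T}) (f : rel T), subgraph e W f -> W != set0 ->
    exists2 u, u \in W & #|[set v | f u v]| <= c.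

Definition is_cover (T : finType) (e : rel T) (k : nat)
    (V : {ffun 'I_k -> {set T}}) : bool :=
  [forall x, forall y, e x y ==> [exists i, (x \in V i) && (y \in V i)]].

Definition width (T : finType) (k : nat) (V : {ffun 'I_k -> {set T}}) : nat :=
  \max_(i < k) #|V i|.

(* For 0 < k the constant family setT is a cover, so the minimum is taken over
   a nonempty set (lemmas OPT_attained and OPT_le); for k = 0 the value is
   meaningless if e has an edge. *)
Definition OPT (T : finType) (e : rel T) (k : nat) : nat :=
  width [arg min_(V < [ffun=> [set: T]] : {ffun 'I_k -> {set T}} | is_cover e V)
           width V].

Lemma is_cover_setT (T : finType) (e : rel T) (k : nat) :
  0 < k -> is_cover e ([ffun=> [set: T]] : {ffun 'I_k -> {set T}}).
Proof.
move=> k0; apply/forallP => x; apply/forallP => y; apply/implyP => _.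
by apply/existsP; exists (Ordinal k0); rewrite !ffunE !inE.
Qed.

Lemma OPT_attained (T : finType) (e : rel T) (k : nat) : 0 < k ->
  exists2 V : {ffun 'I_k -> {set T}}, is_cover e V & width V = OPT e k.
Proof.
move=> k0; rewrite /OPT; case: arg_minnP => [|V cV _]; first exact: is_cover_setT.
by exists V.
Qed.

Lemma OPT_le (T : finType) (e : rel T) (k : nat) (V : {ffun 'I_k -> {set T}}) :
  0 < k -> is_cover e V -> OPT e k <= width V.
Proof.
move=> k0 cV; rewrite /OPT; case: arg_minnP => [|W _ minW]; last exact: minW.
exact: is_cover_setT.
Qed.

(* The random access machine, with logarithmic cost, of S. A. Cook and
   R. A. Reckhow, Time bounded random access machines, J. Comput. Syst. Sci. 7
   (1973), except that registers hold natural numbers, subtraction being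
   truncated.  There are infinitely many registers X_0, X_1, etc, a read-only
   input stream and a write-only output stream. *)

Inductive instr : Type :=
| Const of nat & nat          (* X_i <- a             *)
| Add of nat & nat & nat      (* X_i <- X_j + X_l     *)
| Sub of nat & nat & nat      (* X_i <- X_j - X_l     *)
| Fetch of nat & nat          (* X_i <- X_(X_j)       *)
| Store of nat & nat          (* X_(X_i) <- X_j       *)
| Jpos of nat & nat           (* goto m if X_j > 0    *)
| Read of nat                 (* X_i <- next input    *)
| Write of nat.               (* output X_i           *)

Definition program := seq instr.

Record config := Config {
  pc : nat;
  reg : nat -> nat;
  inp : seq nat;
  out : seq nat }.

Definition upd (r : nat -> nat) (i a : nat) : nat -> nat :=
  fun j => if j == i then a else r j.

(* Reading from an exhausted input stream gives 0. *)
Definition exec (I : instr) (s : config) : config :=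
  let: Config q r x y := s in
  match I with
  | Const i a => Config q.+1 (upd r i a) x y
  | Add i j l => Config q.+1 (upd r i (r j + r l)) x y
  | Sub i j l => Config q.+1 (upd r i (r j - r l)) x y
  | Fetch i j => Config q.+1 (upd r i (r (r j))) x y
  | Store i j => Config q.+1 (upd r (r i) (r j)) x y
  | Jpos j m  => Config (if 0 < r j then m else q.+1) r x y
  | Read i    => Config q.+1 (upd r i (head 0 x)) (behead x) y
  | Write i   => Config q.+1 r x (rcons y (r i))
  end.

(* The number of binary digits of a; 0 has one digit. *)
Definition bitlen (a : nat) : nat := (trunc_log 2 a).+1.

Definition cost (I : instr) (s : config) : nat :=
  let: Config _ r x _ := s in
  match I with
  | Const _ a => bitlen a
  | Add _ j l => bitlen (r j) + bitlen (r l)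
  | Sub _ j l => bitlen (r j) + bitlen (r l)
  | Fetch _ j => bitlen (r j) + bitlen (r (r j))
  | Store i j => bitlen (r i) + bitlen (r j)
  | Jpos j _  => bitlen (r j)
  | Read _    => bitlen (head 0 x)
  | Write i   => bitlen (r i)
  end.

(* run P s t s': started in s, the program P halts in s' after time t.  The
   machine halts when the program counter leaves the program. *)
Inductive run (P : program) : config -> nat -> config -> Prop :=
| run_halt s : size P <= pc s -> run P s 0 s
| run_step s I t s' : onth P (pc s) = Some I -> run P (exec I s) t s' ->
    run P s (cost I s + t) s'.

Definition init (x : seq nat) : config := Config 0 (fun=> 0) x [::].

Definition computes (P : program) (x : seq nat) (t : nat) (y : seq nat) : Prop :=
  exists2 s, run P (init x) t s & out s = y.

Definition input_size (x : seq nat) : nat := \sum_(a <- x) bitlen a.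

(* n, k, then the adjacency matrix row by row.  Since sizes are counted in
   binary digits, k is in effect given in binary. *)
Definition encode_instance (n : nat) (e : rel 'I_n) (k : nat) : seq nat :=
  [:: n, k & [seq nat_of_bool (e x y) | x <- enum 'I_n, y <- enum 'I_n]].

(* A family of k subsets is written as a list of the pairs (i, v) with v in V i,
   in any order, repetitions allowed.  Empty sets take no room, so the length of
   the output need not be exponential in the number of digits of k. *)
Definition encodes_family (n k : nat) (V : {ffun 'I_k -> {set 'I_n}})
    (y : seq nat) : Prop :=
  exists2 L : seq ('I_k * 'I_n),
    y = flatten [seq [:: val p.1; val p.2] | p <- L] &
    forall i v, (v \in V i) = ((i, v) \in L).

(* Main.v *)
Require Import Defs.
From HB Require Import structures.
From mathcomp Require Import all_boot all_order all_algebra.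
From mathcomp Require Import zify.

Set Implicit Arguments.
Unset Strict Implicit.
Unset Printing Implicit Defensive.

(** A vertex with between 1 and c remaining neighbours is repeatedly removed, and
    put together with these neighbours into the sets V_0, ..., V_(k-1) in turn.
    By inductivity this goes on until no edge is left.  If m vertices are
    removed, each set has at most (c + 1) * ceil(m / k) elements; the removed
    vertices are not isolated, hence all covered by any solution, so that
    m <= k * OPT.  The algorithm is written in a small structured language
    compiled to the random access machine.  It is enough to bound the number of
    steps: as there is no multiplication, a step lengthens the numbers by at
    most one digit. *)

(** * Unit cost versus logarithmic cost *)

Definition ram_step (P : program) (s : config) : config :=
  if onth P (pc s) is Some J then exec J s else s.

Lemma ram_stepE P q r x y J :
  onth P q = Some J -> ram_step P (Config q r x y) = exec J (Config q r x y).
Proof. by move=> EJ; rewrite /ram_step /= EJ. Qed.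

Definition const_bits (I : instr) : nat :=
  if I is Const _ a then bitlen a else 0.

Definition fits (b : nat) (s : config) : Prop :=
  (forall i, reg s i < 2 ^ b) /\ (forall a, a \in inp s -> a < 2 ^ b).

(** [b = 0] is excluded because 0 already has one digit. *)
Lemma bitlen_leq a b : 0 < b -> (bitlen a <= b) = (a < 2 ^ b).
Proof.
move=> b0; apply/idP/idP => [ab|lt_ab].
  by apply: leq_trans (trunc_log_ltn a (isT : 1 < 2)) _; rewrite leq_exp2l.
have [->|a0] := posnP a; first by rewrite /bitlen trunc_log0.
rewrite /bitlen -(ltn_exp2l _ _ (isT : 1 < 2)).
exact: leq_ltn_trans (trunc_logP (isT : 1 < 2) a0) lt_ab.
Qed.

Lemma cost_fits b I s : 0 < b -> fits b s -> const_bits I <= b ->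
  cost I s <= b + b.
Proof.
move=> b0 [rb xb]; have lb i : bitlen (reg s i) <= b by rewrite bitlen_leq.
have hb : bitlen (head 0 (inp s)) <= b.
  rewrite bitlen_leq //; case: (inp s) xb => [|a x] /= xb; last by rewrite xb ?mem_head.
  by rewrite expn_gt0.
case: s {rb xb} lb hb => q r x y /= lb hb.
case: I => /= *; by [exact: leq_add | apply: leq_trans (leq_addr _ _)].
Qed.

(** Only an addition or a constant can exceed the old bound: a sum of two numbers below [2 ^ b]
    stays below [2 ^ b.+1], and constants fit by hypothesis. *)
Lemma exec_fits b I s : fits b s -> const_bits I <= b.+1 -> fits b.+1 (exec I s).
Proof.
have up a : a < 2 ^ b -> a < 2 ^ b.+1.
  by move=> ab; rewrite expnS mul2n -addnn ltn_addr.
case: s => q r x y [/= rb xb] cb.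
have updb i a : a < 2 ^ b.+1 -> forall j, upd r i a j < 2 ^ b.+1.
  by move=> ab j; rewrite /upd; case: ifP => _ //; apply: up.
case: I cb => /= [i a|i j l|i j l|i j|i j|j m|i|i] cb; split=> //= a'; last 2 first.
- by apply: up.
- by move/xb/up.
- by apply: updb; rewrite -bitlen_leq.
- by move/xb/up.
- by apply: updb; rewrite expnS mul2n -addnn -addSn leq_add // ltnW.
- by move/xb/up.
- by apply: updb; apply: up; apply: leq_ltn_trans (leq_subr _ _) _.
- by move/xb/up.
- by apply: updb; apply: up.
- by move/xb/up.
- by apply: updb; apply: up.
- by move/xb/up.
- by apply: up.
- by move/xb/up.
- apply: updb; case: x xb => [|a x] /= xb; first by rewrite expn_gt0.
  by apply: up; apply: xb; rewrite mem_head.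
- by move/mem_behead/xb/up.
Qed.

(** Numbers gain at most one digit per step, so those met within [m] steps have at most [b + m]
    digits and each step costs at most twice that. The induction trades a step for a digit: its
    hypothesis is used with [b.+1]. *)
Lemma run_of_iter P b m s : 0 < b -> fits b s ->
    (forall i I, onth P i = Some I -> const_bits I <= b) ->
    size P <= pc (iter m (ram_step P) s) ->
  exists2 t, run P s t (iter m (ram_step P) s) & t <= m * (b + m).*2.
Proof.
elim: m b s => [|m IHm] b s b0 sb Pb halts.
  by exists 0; first exact: run_halt.
case E: (onth P (pc s)) => [I|]; last first.
  (* A halted machine is a fixed point of [ram_step], so [m] may exceed the halting time. *)
  have fixs j : iter j (ram_step P) s = s by elim: j => //= j ->; rewrite /ram_step E.
  by rewrite fixs in halts *; exists 0; first exact: run_halt.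
have Eiter : iter m.+1 (ram_step P) s = iter m (ram_step P) (exec I s).
  by rewrite iterSr /ram_step E.
rewrite Eiter in halts *.
have [||||t runt tle] := IHm b.+1 (exec I s) => //.
- by apply: exec_fits sb _; apply: leqW; apply: Pb E.
- by move=> i J /Pb; apply: leqW.
exists (cost I s + t); first exact: run_step E runt.
rewrite mulSn -addnn; apply: leq_add.
  by apply: leq_trans (cost_fits b0 sb (Pb _ _ E)) _; lia.
by move: tle; rewrite -addnn addSnnS.
Qed.

(** * Structured programs *)

(* [Unless j C] runs C if X_j = 0; [Repeat j C] runs C at least once, until
   X_j = 0.  Both compile to a single jump without auxiliary register. *)
Inductive cmd : Type :=
| Block of seq instr
| Seq of cmd & cmd
| Unless of nat & cmd
| Repeat of nat & cmd.

(** Jump targets are absolute, hence the load address [q]. *)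
Fixpoint compile (q : nat) (C : cmd) : program :=
  match C with
  | Block l => l
  | Seq C1 C2 => let l := compile q C1 in l ++ compile (q + size l) C2
  | Unless j C => let l := compile q.+1 C in Jpos j (q.+1 + size l) :: l
  | Repeat j C => rcons (compile q C) (Jpos j q)
  end.

Definition code_at (P : program) (q : nat) (l : program) : Prop :=
  forall i I, onth l i = Some I -> onth P (q + i) = Some I.

Lemma code_at_cat P q l1 l2 : code_at P q (l1 ++ l2) ->
  code_at P q l1 /\ code_at P (q + size l1) l2.
Proof.
move=> cP; split=> i I Ei.
  apply: cP; rewrite onth_cat -Ei; case: ifP => // /negbT; rewrite -leqNgt => h.
  by rewrite onth_default // in Ei.
by rewrite -addnA; apply: cP; rewrite onth_cat ltnNge leq_addr /= addKn.
Qed.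

Lemma code_at_cons P q I l : code_at P q (I :: l) ->
  onth P q = Some I /\ code_at P q.+1 l.
Proof.
rewrite -cat1s => /code_at_cat [/(_ 0 I erefl)]; rewrite addn0 => EI.
by rewrite addn1.
Qed.

(** * Total correctness rules for structured programs *)

Definition assertion := (nat -> nat) -> seq nat -> seq nat -> Prop.

(* The total correctness predicate transformer, T bounding the number of steps. *)
Definition wp (C : cmd) (T : nat) (Q : assertion) : assertion :=
  fun r x y => forall P q, code_at P q (compile q C) ->
    exists2 t, t <= T & exists r' x' y', Q r' x' y' /\
      iter t (ram_step P) (Config q r x y) =
        Config (q + size (compile q C)) r' x' y'.

Lemma wp_leq C T T' Q r x y : T <= T' -> wp C T Q r x y -> wp C T' Q r x y.
Proof.
move=> leT wpC P q /wpC[t tT post]; exists t => //; exact: leq_trans leT.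
Qed.

(** Symbolic execution of straight-line code, which unfolds by computation. The program counter 0 is
    a dummy, and a jump is rejected. *)
Fixpoint block_post (l : seq instr) (Q : assertion) : assertion :=
  fun r x y =>
  if l is J :: l' then
    if J is Jpos _ _ then False else
    let s := exec J (Config 0 r x y) in
    block_post l' Q (reg s) (inp s) (out s)
  else Q r x y.

Lemma wp_block l Q r x y : block_post l Q r x y -> wp (Block l) (size l) Q r x y.
Proof.
move=> + P q; rewrite /=; elim: l q r x y => [|I l IHl] q r x y /=.
  by move=> post _; exists 0 => //; exists r, x, y; rewrite addn0.
move=> post /code_at_cons[EI cl].
have {}post : let s := exec I (Config q r x y) in
    block_post l Q (reg s) (inp s) (out s) /\ pc s = q.+1.
  by case: I post {EI}.
case: post; case E: (exec I (Config q r x y)) => [q' r1 x1 y1] /= post Eq.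
rewrite {}Eq in E.
have [t tl [r' [x' [y' [post' E']]]]] := IHl _ _ _ _ post cl.
exists t.+1 => //; exists r', x', y'; split=> //.
by rewrite iterSr (ram_stepE _ _ _ EI) E E' addSnnS.
Qed.

Lemma wp_seq C1 C2 T1 T2 Q r x y :
  wp C1 T1 (wp C2 T2 Q) r x y -> wp (Seq C1 C2) (T1 + T2) Q r x y.
Proof.
move=> wp1 P q /= /code_at_cat[/wp1[t1 t1T [r1 [x1 [y1 [wp2 E1]]]]]].
move=> /wp2[t2 t2T [r2 [x2 [y2 [post E2]]]]].
exists (t2 + t1); first by rewrite addnC leq_add.
by exists r2, x2, y2; rewrite iterD E1 E2 size_cat addnA.
Qed.

Lemma wp_unless j C T Q r x y :
  (r j = 0 -> wp C T Q r x y) -> (0 < r j -> Q r x y) ->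
  wp (Unless j C) T.+1 Q r x y.
Proof.
move=> wpC post P q /= /code_at_cons[EI cC].
have [rj0|rj] := posnP (r j); last first.
  exists 1 => //; exists r, x, y; split; first exact: post.
  by rewrite /= /ram_step /= EI /= rj addSnnS.
have [t tT [r' [x' [y' [post' E]]]]] := wpC rj0 _ _ cC.
exists t.+1 => //; exists r', x', y'; split=> //.
by rewrite iterSr (ram_stepE _ _ _ EI) /= rj0 E addSnnS.
Qed.

(** [Inv i] holds after [i] rounds. The value [N - i.+1] of X_j at the end of a round forces exactly
    [N] rounds; [0 < N] because the test comes after the body, and [T.+1] counts the jump. *)
Lemma wp_repeat N (Inv : nat -> assertion) j C T (Q : assertion) r x y :
  0 < N -> Inv 0 r x y ->
  (forall (i : 'I_N) r x y, Inv i r x y ->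
    wp C T (fun r' x' y' => Inv i.+1 r' x' y' /\ r' j = N - i.+1) r x y) ->
  (forall r' x' y', Inv N r' x' y' -> Q r' x' y') ->
  wp (Repeat j C) (N * T.+1) Q r x y.
Proof.
move=> N0 inv0 step post P q /=; rewrite -cats1 => /code_at_cat[cC].
case/code_at_cons=> EJ _.
(* Induction on the number [m] of rounds still to do. *)
suff: forall m r x y, 0 < m <= N -> Inv (N - m) r x y ->
    exists2 t, t <= m * T.+1 & exists r' x' y', Inv N r' x' y' /\
      iter t (ram_step P) (Config q r x y) =
        Config (q + size (compile q C)).+1 r' x' y'.
  case/(_ N r x y); rewrite ?N0 ?leqnn ?subnn // => t tT [r' [x' [y' [/post ? E]]]].
  by exists t => //; exists r', x', y'; rewrite size_cat addn1 addnS.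
elim=> // m IHm {inv0}r {}x {}y /= mN inv.
have ltN : N - m.+1 < N by rewrite ltn_subrL.
have [t tT [r1 [x1 [y1 [[inv1 rj] E1]]]]] := step (Ordinal ltN) _ _ _ inv _ _ cC.
have Em : N - (N - m) = m by rewrite subKn // ltnW.
move: rj inv1; rewrite /= subnSK // Em => rj inv1.
have E2 : ram_step P (Config (q + size (compile q C)) r1 x1 y1) =
    Config (if 0 < m then q else (q + size (compile q C)).+1) r1 x1 y1.
  by rewrite /ram_step /= EJ /= rj.
have [m0|m0] := posnP m.
  exists t.+1; first by rewrite m0 mul1n.
  exists r1, x1, y1; split; first by rewrite m0 subn0 in inv1.
  by rewrite iterS E1 E2 m0.
have [|t2 t2T [r2 [x2 [y2 [inv2 E3]]]]] := IHm _ _ _ _ inv1.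
  by rewrite m0 ltnW.
exists (t2 + t.+1); first by rewrite mulSn addnC leq_add.
by exists r2, x2, y2; rewrite iterD iterS E1 E2 m0 E3.
Qed.

(** * The greedy algorithm *)

Section Greedy.
Variables (n : nat) (e : rel 'I_n) (c k : nat) (k_gt0 : 0 < k).

(* L lists the removed vertices, the i-th one of which uses the set i %% k. *)
Definition live (L : seq 'I_n) (u : 'I_n) : seq 'I_n :=
  [seq v <- enum 'I_n | e u v && (v \notin L)].

Definition bin (m : nat) : 'I_k := Ordinal (ltn_pmod m k_gt0).

(** The pair [(i, u)] is repeated for every [v], as the program writes it afresh with each
    neighbour; the output format allows repetitions. *)
Definition star (i : 'I_k) (u : 'I_n) (s : seq 'I_n) : seq ('I_k * 'I_n) :=
  flatten [seq [:: (i, u); (i, v)] | v <- s].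

Definition removable (L : seq 'I_n) (u : 'I_n) : bool :=
  (u \notin L) && (0 < size (live L u) <= c).

Definition visit (st : seq 'I_n * seq ('I_k * 'I_n)) (u : 'I_n) :=
  let: (L, A) := st in
  if removable L u then (rcons L u, A ++ star (bin (size L)) u (live L u))
  else st.

Definition pass st := foldl visit st (enum 'I_n).

(** [n] passes suffice: each one removes a vertex as long as an edge is left, and there are only [n]
    vertices. *)
Definition greedy := iter n pass ([::], [::]).

Definition fiber (A : seq ('I_k * 'I_n)) (i : 'I_k) : {set 'I_n} :=
  [set v | (i, v) \in A].

(* (m + (k - 1 - i)) / k is the number of indices below m congruent to i. *)
Definition load (m : nat) (i : 'I_k) : nat := (m + (k.-1 - i)) %/ k.

Lemma load_mono m i : load m i <= load m.+1 i.
Proof. by rewrite leq_div2r // leq_add2r. Qed.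

(** A quotient by [k] increases when the new numerator is a multiple of [k]; for the index [m %% k]
    this numerator is [m %/ k * k + k]. *)
Lemma load_bin m : load m.+1 (bin m) = (load m (bin m)).+1.
Proof.
rewrite /load addSn divnS //.
suff -> : k %| (m + (k.-1 - bin m)).+1 by [].
have lt_mk := ltn_pmod m k_gt0.
have -> : (m + (k.-1 - bin m)).+1 = m %/ k * k + k.
  by rewrite [X in X + (k.-1 - _)](divn_eq m k) /=; lia.
by rewrite dvdn_addl // dvdn_mull.
Qed.

Lemma mem_star (p : 'I_k * 'I_n) i u s :
  p \in star i u s -> p.1 = i /\ p.2 \in u :: s.
Proof.
case/flatten_mapP=> v sv; rewrite !inE => /orP[]/eqP-> /=; split=> //.
  by rewrite eqxx.
by rewrite sv orbT.
Qed.

Record greedy_inv (st : seq 'I_n * seq ('I_k * 'I_n)) : Prop := GreedyInv {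
  inv_uniq : uniq st.1;
  inv_nonisolated : forall u, u \in st.1 -> exists v, e u v;
  inv_covered : forall x y, e x y -> (x \in st.1) || (y \in st.1) ->
    exists i, (i, x) \in st.2 /\ (i, y) \in st.2;
  inv_load : forall i, #|fiber st.2 i| <= c.+1 * load (size st.1) i }.

Hypothesis sym_e : symmetric e.

Lemma greedy_inv0 : greedy_inv ([::], [::]).
Proof.
by split=> //= i; rewrite [fiber _ _](_ : _ = set0) ?cards0.
Qed.

(** An edge touching the removed vertices for the first time joins [u] to a live neighbour, and both
    enter the set [i]. This set gains at most [c.+1] vertices while its load grows by one; the other
    sets do not change. *)
Lemma visit_inv st u : greedy_inv st -> greedy_inv (visit st u).
Proof.
case: st => L A [/= uL nL cL lL]; case: ifP => // /and3P[uNL d0 dc].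
set i := bin (size L); set N := live L u.
have in_star v : v \in N -> (i, u) \in star i u N /\ (i, v) \in star i u N.
  move=> vN; split; apply/flatten_mapP; exists v; rewrite // !inE ?eqxx //.
  by rewrite orbT.
split=> /= [|w|x y exy|i'].
- by rewrite rcons_uniq uNL.
- rewrite mem_rcons inE => /orP[/eqP->|/nL //].
  case E: N d0 => [|v s]; first by rewrite /N in E; rewrite E.
  move=> _; exists v; have: v \in N by rewrite E mem_head.
  by rewrite mem_filter => /andP[/andP[]].
- have [/(cL _ _ exy)[j [jx jy]] _|] := boolP ((x \in L) || (y \in L)).
    by exists j; rewrite !mem_cat jx jy.
  rewrite negb_or => /andP[xL yL].
  rewrite !mem_rcons !inE (negPf xL) (negPf yL) !orbF.
  case/orP=> /eqP Eu; exists i; rewrite !mem_cat.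
    have /in_star[] : y \in N by rewrite mem_filter -Eu exy yL mem_enum.
    by rewrite Eu => -> ->; rewrite !orbT.
  have /in_star[] : x \in N by rewrite mem_filter -Eu sym_e exy xL mem_enum.
  by rewrite Eu => -> ->; rewrite !orbT.
- rewrite size_rcons; have [->|neq] := eqVneq i' i.
    rewrite load_bin mulnS addnC.
    have sub : fiber (A ++ star i u N) i \subset fiber A i :|: [set v in u :: N].
      apply/subsetP=> v; rewrite in_set mem_cat => /orP[Av|/mem_star[_ vN]].
        by rewrite !inE Av.
      by rewrite in_setU inE [X in _ || X]inE vN orbT.
    apply: leq_trans (subset_leq_card sub) _; apply: leq_trans (leq_card_setU _ _) _.
    apply: leq_add; first exact: lL.
    by rewrite cardsE; apply: leq_trans (card_size _) _.
  have -> : fiber (A ++ star i u N) i' = fiber A i'.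
    apply/setP=> v; rewrite !inE mem_cat; apply/orb_idr => /mem_star[/= E].
    by rewrite E eqxx in neq.
  by apply: leq_trans (lL i') _; rewrite leq_mul2l load_mono orbT.
Qed.

Lemma greedy_inv_pass m : greedy_inv (iter m pass ([::], [::])).
Proof.
elim: m => [|m IHm]; first exact: greedy_inv0.
rewrite iterS /pass; elim: (enum _) (iter m _ _) IHm => //= u s IHs st ist.
by apply: IHs; apply: visit_inv.
Qed.

(** Up to the first removal the state is still [st], so the equality case speaks of removability in
    the initial state. *)
Lemma size_visits s st : size st.1 <= size (foldl visit st s).1 ?= iff
  all (fun u => ~~ removable st.1 u) s.
Proof.
elim: s st => [|u s IHs] [L A] /=; first by split; rewrite /= ?leqnn ?eqxx.
case: ifP => /= rem; last exact: IHs.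
have [le _] := IHs (rcons L u, A ++ star (bin (size L)) u (live L u)).
by move: le; rewrite /= size_rcons => le; split; [exact: ltnW | rewrite ltn_eqF].
Qed.

(** * Termination: no edge is left after [n] passes *)

Definition finished (L : seq 'I_n) := forall x y, e x y -> (x \in L) || (y \in L).

Hypothesis ind_e : inductive_graph c e.

(* Inductivity is applied to the graph left after removing L, restricted to its
   non-isolated vertices. *)
Lemma removable_exists (L : seq 'I_n) x y : e x y -> x \notin L -> y \notin L ->
  exists u, removable L u.
Proof.
move=> exy xL yL.
pose f a b := [&& e a b, a \notin L & b \notin L].
pose W := [set u | [exists v, f u v]].
have sym_f : symmetric f by move=> a b; rewrite /f sym_e [X in _ && X]andbC.
have Wl a b : f a b -> a \in W by move=> fab; rewrite inE; apply/existsP; exists b.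
have Wr a b : f a b -> b \in W by move=> fab; apply: (Wl _ a); rewrite sym_f.
have [||u uW du] := ind_e (W := W) (f := f).
- split=> // [a b /and3P[]//|a b fab].
  by rewrite (Wl _ _ fab) (Wr _ _ fab).
- by apply/set0Pn; exists x; apply: (Wl _ y); rewrite /f exy xL.
- move: uW; rewrite inE => /existsP[v fuv]; have /and3P[euv uL vL] := fuv.
  (* Membership in [W] gives a live neighbour, inductivity the upper bound [c] on their number. *)
  exists u; rewrite /removable uL -has_predT /=; apply/andP; split.
    by apply/hasP; exists v; rewrite // mem_filter euv vL mem_enum.
  have uN : uniq (live L u) by apply: filter_uniq; apply: enum_uniq.
  rewrite -(card_uniqP uN).
  apply: leq_trans du; apply/subset_leq_card/subsetP=> w.
  by rewrite mem_filter inE /f uL => /andP[].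
Qed.

(** A pass that removes nothing shows that no vertex is removable, hence by [removable_exists] that
    no edge is left; any other pass makes the list longer. *)
Lemma pass_progress m : let L := (iter m pass ([::], [::])).1 in
  finished L \/ m <= size L.
Proof.
elim: m => [|m] /=; first by right.
set st := iter m pass _; case=> [fin|le_m].
  left=> x y /fin.
  have sub s st' : {subset st'.1 <= (foldl visit st' s).1}.
    elim: s st' => [|u s IHs] [L A] z //= zL; apply: IHs => /=.
    by case: ifP => //= _; rewrite mem_rcons inE zL orbT.
  by case/orP=> /(sub (enum 'I_n)) ->; rewrite ?orbT.
have [le eqst] := size_visits (enum 'I_n) st.
have [|nr] := boolP (all (fun u => ~~ removable st.1 u) (enum 'I_n)); last first.
  by right; rewrite -/(pass st) in le eqst *; move: le; rewrite leq_eqVlt eqst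
    (negPf nr) /=; exact: leq_ltn_trans.
move=> /allP none; left.
have fin : finished st.1.
  move=> x y exy; apply/negPn/negP; rewrite negb_or => /andP[xL yL].
  have [u /negPn/negP[]] := removable_exists exy xL yL.
  by apply: none; rewrite mem_enum.
suff -> : pass st = st by [].
rewrite /pass; elim: (enum _) none => //= u s IHs none.
have -> : visit st u = st.
  by case: st none {IHs le eqst le_m fin} => L A /(_ u (mem_head _ _)) /= /negPf->.
by apply: IHs => v vs; apply: none; rewrite inE vs orbT.
Qed.

Lemma greedy_finished : finished greedy.1.
Proof.
have [//|le_n] := pass_progress n; move=> x y _; rewrite orbC.
have [uL _ _ _] := greedy_inv_pass n.
suff -> : y \in greedy.1 by [].
(* A duplicate-free list of at least [n] vertices contains them all. *)
have /subset_leqif_card[_] := subset_predT (mem greedy.1).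
by rewrite (card_uniqP uL) card_ord eqn_leq le_n -[X in _ <= X]card_ord
  -(card_uniqP uL) max_card => /esym/subsetP->.
Qed.

(** * The resulting cover and its width against the optimum *)

Definition greedy_cover : {ffun 'I_k -> {set 'I_n}} := [ffun i => fiber greedy.2 i].

Lemma greedy_is_cover : is_cover e greedy_cover.
Proof.
apply/forallP=> x; apply/forallP=> y; apply/implyP=> exy.
have [i [ix iy]] := inv_covered (greedy_inv_pass n) exy (greedy_finished exy).
by apply/existsP; exists i; rewrite !ffunE !inE ix iy.
Qed.

(** This is the lower bound on the optimum: each vertex of [L] is an endpoint of an edge, so it lies
    in the union of the [k] sets. *)
Lemma nonisolated_le_cover (V : {ffun 'I_k -> {set 'I_n}}) (L : seq 'I_n) :
  is_cover e V -> uniq L -> (forall u, u \in L -> exists v, e u v) ->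
  size L <= k * width V.
Proof.
move=> cV uL nL; rewrite -(card_uniqP uL).
apply: (@leq_trans #|\bigcup_i V i|).
  apply/subset_leq_card/subsetP=> u /nL[v euv].
  have /forallP/(_ u)/forallP/(_ v)/implyP/(_ euv)/existsP[i /andP[ui _]] := cV.
  by apply/bigcupP; exists i.
apply: (@leq_trans (\sum_i #|V i|)).
  elim/big_ind2: _ => [|A a B b leA leB|//]; first by rewrite cards0.
  exact: leq_trans (leq_card_setU _ _) (leq_add leA leB).
rewrite -[X in X * _]card_ord -sum_nat_const leq_sum // => i _.
exact: (leq_bigmax (F := fun i => #|V i|)).
Qed.

Lemma width_greedy_cover : width greedy_cover <= c.+1 * OPT e k.
Proof.
have [uL nL _ lL] := greedy_inv_pass n.
have [V cV <-] := OPT_attained e k_gt0.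
apply/bigmax_leqP=> i _; rewrite ffunE; apply: leq_trans (lL i) _.
rewrite leq_mul2l /=.
have := nonisolated_le_cover cV uL nL; rewrite /load => le.
apply: (@leq_trans ((k * width V + (k.-1 - i)) %/ k)).
  by rewrite leq_div2r // leq_add2r.
(* As [k.-1 - i < k], rounding up adds nothing to an exact multiple of [k]. *)
by rewrite mulnC divnMDl // divn_small ?addn0 //; lia.
Qed.

End Greedy.

(** * The greedy algorithm as a program *)

(* Registers: X_0 = 0, X_1 = n, X_2 = k, X_3 = 1, X_4 = c, X_12 = size L %% k.
   The vertices of L are marked in X_32, ..., X_(32+n-1), and the adjacency
   matrix follows row by row.  In the loop over u, X_14 = u, and X_15 and X_18
   are the addresses of the row of u and of the mark of u. *)

Notation "C1 ;; C2" := (Seq C1 C2) (at level 61, right associativity).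

(* X_11 <- the number of unmarked neighbours of u. *)
Definition degree_cmd : cmd :=
  Block [:: Const 11 0; Add 6 15 0; Const 7 32; Add 8 1 0] ;;
  Repeat 8 (Block [:: Fetch 9 6; Fetch 10 7; Defs.Sub 9 9 10; Add 11 11 9;
                      Add 6 6 3; Add 7 7 3; Defs.Sub 8 8 3]).

(** X_17 runs over the vertices. The truncated difference of edge bit and mark is 1 exactly at a
    live neighbour; X_5 negates it, since [Unless] runs its body at zero. *)
Definition emit_cmd : cmd :=
  Block [:: Const 17 0; Add 6 15 0; Const 7 32; Add 8 1 0] ;;
  Repeat 8 (Block [:: Fetch 9 6; Fetch 10 7; Defs.Sub 9 9 10; Defs.Sub 5 3 9] ;;
            Unless 5 (Block [:: Write 12; Write 14; Write 12; Write 17]) ;;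
            Block [:: Add 17 17 3; Add 6 6 3; Add 7 7 3; Defs.Sub 8 8 3]).

(** X_12 advances modulo [k] without a division: it is reset when it reaches [k]. *)
Definition mark_cmd : cmd :=
  Block [:: Store 18 3; Add 12 12 3; Defs.Sub 5 2 12] ;;
  Unless 5 (Block [:: Const 12 0]).

(* After the first block, X_5 = 0 iff 1 <= X_11 <= c and u is not marked. *)
Definition visit_cmd : cmd :=
  degree_cmd ;;
  Block [:: Fetch 10 18; Defs.Sub 5 3 11; Defs.Sub 9 11 4; Add 5 5 9; Add 5 5 10] ;;
  Unless 5 (emit_cmd ;; mark_cmd) ;;
  Block [:: Add 14 14 3; Add 18 18 3; Add 15 15 1; Defs.Sub 16 16 3].

Definition pass_cmd : cmd :=
  Block [:: Const 14 0; Const 18 32; Add 15 18 1; Add 16 1 0] ;;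
  Repeat 16 visit_cmd ;;
  Block [:: Defs.Sub 13 13 3].

(** For want of a multiplication, [n * n] is accumulated in X_19 by repeated addition, then counts
    the matrix entries to read. *)
Definition read_cmd : cmd :=
  Block [:: Add 8 1 0] ;;
  Repeat 8 (Block [:: Add 19 19 1; Defs.Sub 8 8 3]) ;;
  Block [:: Const 6 32; Add 6 6 1] ;;
  Repeat 19 (Block [:: Read 9; Store 6 9; Add 6 6 3; Defs.Sub 19 19 3]).

(** The case [n = 0] is skipped, because [Repeat] runs its body at least once. *)
Definition greedy_cmd (c : nat) : cmd :=
  Block [:: Const 3 1; Const 4 c; Read 1; Read 2; Defs.Sub 5 3 1] ;;
  Unless 5 (read_cmd ;; Block [:: Add 13 1 0] ;; Repeat 13 pass_cmd).

Definition same_off (l : seq nat) (r r' : nat -> nat) : Prop :=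
  forall a, a \notin l -> r' a = r a.

Lemma same_off_refl l r : same_off l r r. Proof. by []. Qed.

Lemma same_off_upd l r r' i v :
  i \in l -> same_off l r r' -> same_off l r (upd r' i v).
Proof.
move=> il sr a al; rewrite /upd; case: eqP => [Ea|_]; last exact: sr.
by rewrite Ea il in al.
Qed.

Ltac frame := do ?[apply: same_off_upd => //]; first [done | exact: same_off_refl].

Lemma high_eqF a i : i < 32 -> (32 + a == i) = false.
Proof. by move=> ?; apply/eqP; lia. Qed.

Definition encode_pairs (n k : nat) (A : seq ('I_k * 'I_n)) : seq nat :=
  flatten [seq [:: val p.1; val p.2] | p <- A].

Lemma encode_pairs_cat n k (A B : seq ('I_k * 'I_n)) :
  encode_pairs (A ++ B) = encode_pairs A ++ encode_pairs B.
Proof. by rewrite /encode_pairs map_cat flatten_cat. Qed.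

Lemma take_enum_ordS n (i : 'I_n) :
  take i.+1 (enum 'I_n) = rcons (take i (enum 'I_n)) i.
Proof. by rewrite (take_nth i) ?size_enum_ord // nth_ord_enum. Qed.

Lemma wp_read n r x y (Q : assertion) :
  0 < n -> r 0 = 0 -> r 1 = n -> r 3 = 1 -> r 19 = 0 -> size x = n * n ->
  (forall r', (forall a, a \notin [:: 6; 8; 9; 19] -> a < 32 + n -> r' a = r a) ->
     (forall i, i < n * n -> r' (32 + (n + i)) = nth 0 x i) -> Q r' [::] y) ->
  wp read_cmd (n * n * 5 + n * 3 + 3) Q r x y.
Proof.
move=> n_gt0 r0 r1 r3 r19 szx post.
apply: (@wp_leq _ (1 + (n * 3 + (2 + n * n * 5)))); first by lia.
apply: wp_seq; apply: wp_block => /=; apply: wp_seq.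
pose Inv1 m r' x' y' := [/\ same_off [:: 8; 19] r r', r' 8 = n - m,
  r' 19 = m * n, x' = x & y' = y].
apply: (@wp_repeat n Inv1) => //.
- by rewrite /Inv1 /upd /= r0 r1 r19 addn0 subn0; split=> //; frame.
- move=> m r' x' y' [sr r8 r'19 -> ->]; apply: wp_block => /=.
  rewrite /Inv1 /upd /= (sr 1) // (sr 3) // r1 r3 r8 r'19.
  by split; [split=> //; [frame | lia | lia] | lia].
move=> r' _ _ [sr r8 r'19 -> ->]; apply: wp_seq; apply: wp_block => /=.
pose Inv2 m r2 x' y' := [/\ r2 6 = 32 + (n + m), r2 19 = n * n - m,
  x' = drop m x, y' = y &
  (forall a, a \notin [:: 6; 8; 9; 19] -> a < 32 + n -> r2 a = r a) /\
  (forall i, i < m -> r2 (32 + (n + i)) = nth 0 x i)].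
apply: (@wp_repeat (n * n) Inv2).
- by rewrite muln_gt0 n_gt0.
- rewrite /Inv2 /upd /= sr // r1 r'19 addn0 subn0 drop0; split=> //; split=> //.
  move=> a; rewrite !inE !negb_or => /and4P[/negPf-> a8 _ a19] _.
  by apply: sr; rewrite !inE negb_or a8.
- move=> m r2 x' y' [r26 r219 -> -> [low high]]; apply: wp_block => /=.
  have r23 : r2 3 = 1 by rewrite low.
  have headE : head 0 (drop m x) = nth 0 x m by rewrite -nth0 nth_drop addn0.
  rewrite headE [upd r2 9 _ 6]r26 [upd r2 9 _ 9]/(nth 0 x m) /Inv2.
  split; last by rewrite /upd /= r219 r23; lia.
  split.
  + by rewrite /upd /= r26 r23; lia.
  + by rewrite /upd /= r219 r23; lia.
  + by rewrite -drop1 drop_drop addnC addn1.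
  + by [].
  split=> [a|i].
    rewrite !inE !negb_or => /and4P[a6 a8 a9 a19] lt_a.
    rewrite /upd (negPf a19) (negPf a6) (negPf a9).
    case: eqP => [Ea|_]; first by lia.
    by apply: low => //; rewrite !inE !negb_or a6 a8 a9.
  rewrite ltnS leq_eqVlt => im.
  rewrite /upd (@high_eqF _ 19) // (@high_eqF _ 6) // (@high_eqF _ 9) //.
  rewrite !eqn_add2l.
  by case: eqP im => [-> //|_ /= /high].
- move=> r2 x' y' [_ _ -> -> [low high]].
  by rewrite drop_oversize ?szx //; apply: post.
Qed.

(** * Simulation of the greedy algorithm by the program *)

Section Correctness.
Variables (n : nat) (e : rel 'I_n) (c k : nat) (k_gt0 : 0 < k).
Hypothesis n_gt0 : 0 < n.

Record good (st : seq 'I_n * seq ('I_k * 'I_n)) (r : nat -> nat) (y : seq nat) :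
    Prop := Good {
  good0 : r 0 = 0;
  good1 : r 1 = n;
  good2 : r 2 = k;
  good3 : r 3 = 1;
  good4 : r 4 = c;
  good12 : r 12 = size st.1 %% k;
  good_mark : forall v : 'I_n, r (32 + v) = (v \in st.1);
  good_edge : forall u v : 'I_n, r (32 + (n + u * n + v)) = e u v;
  good_out : y = encode_pairs st.2 }.

(** X_12 is kept out since [good] constrains it between visits. *)
Definition scratch (i : nat) : bool := (4 < i < 32) && (i != 12).

Lemma good_same_off l st r r' y :
  all scratch l -> same_off l r r' -> good st r y -> good st r' y.
Proof.
move=> /allP ls srr' [h0 h1 h2 h3 h4 h12 hm he hy].
have low i : ~~ scratch i -> r' i = r i.
  by move=> si; apply: srr'; apply: contra si => /ls.
have high i : r' (32 + i) = r (32 + i) by exact: low.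
by split=> // [|||||| v|u v]; rewrite ?low // high.
Qed.

Definition live_upto (L : seq 'I_n) (u : 'I_n) (m : nat) : seq 'I_n :=
  [seq v <- take m (enum 'I_n) | e u v && (v \notin L)].

Lemma live_upto0 L u : live_upto L u 0 = [::].
Proof. by rewrite /live_upto take0. Qed.

Lemma live_uptoS L u (v : 'I_n) : live_upto L u v.+1 =
  if e u v && (v \notin L) then rcons (live_upto L u v) v else live_upto L u v.
Proof. by rewrite /live_upto take_enum_ordS filter_rcons. Qed.

Lemma live_upto_all L u : live_upto L u n = live e L u.
Proof. by rewrite /live_upto take_oversize // size_enum_ord. Qed.

Lemma wp_degree st (u : 'I_n) r x y (Q : assertion) :
  good st r y -> r 15 = 32 + (n + u * n) ->
  (forall r', same_off [:: 6; 7; 8; 9; 10; 11] r r' ->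
     r' 11 = size (live e st.1 u) -> Q r' x y) ->
  wp degree_cmd (4 + n * 8) Q r x y.
Proof.
move=> gst r15 post; apply: wp_seq; apply: wp_block => /=.
set l := [:: 6; _; _; _; _; _] in post.
pose Inv m r' x' y' := [/\ same_off l r r', r' 6 = 32 + (n + u * n + m),
  r' 7 = 32 + m, r' 8 = n - m & [/\ r' 11 = size (live_upto st.1 u m),
  x' = x & y' = y]].
apply: (@wp_repeat n Inv) => //.
- split=> //; rewrite /upd /= ?live_upto0 ?(good0 gst) ?(good1 gst) ?subn0 ?addn0 //.
  by frame.
- move=> v r' x' y' [sr r6 r7 r8 [r11 -> ->]].
  have g : good st r' y by apply: good_same_off sr gst.
  apply: wp_block => /=.
  have r3 := good3 g; have rm := good_mark g v; have re := good_edge g u v.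
  split; last by rewrite /upd /= r8 r3; lia.
  split=> //; first by frame.
  + by rewrite /upd /= r6 r3; lia.
  + by rewrite /upd /= r7 r3; lia.
  + by rewrite /upd /= r8 r3; lia.
  + rewrite /upd /= r6 r7 !high_eqF // re rm r11 live_uptoS.
    by case: (e u v); case: (v \in st.1); rewrite //= ?addn0 ?addn1 ?size_rcons.
- move=> r' x' y' [sr _ _ _ [r11 -> ->]].
  by apply: post; rewrite // -live_upto_all.
Qed.

Lemma wp_emit L A (u : 'I_n) r x y (Q : assertion) :
  good (L, A) r y -> r 15 = 32 + (n + u * n) -> r 14 = u ->
  (forall r' y', same_off [:: 5; 6; 7; 8; 9; 10; 17] r r' ->
     y' = encode_pairs (A ++ star (bin k_gt0 (size L)) u (live e L u)) ->
     Q r' x y') ->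
  wp emit_cmd (4 + n * 14) Q r x y.
Proof.
move=> gst r15 r14 post; apply: wp_seq; apply: wp_block => /=.
set l := [:: 5; _; _; _; _; _; _] in post.
set i := bin k_gt0 (size L) in post.
pose Inv m r' x' y' := [/\ same_off l r r', r' 6 = 32 + (n + u * n + m),
  r' 7 = 32 + m, r' 8 = n - m & [/\ r' 17 = m, x' = x &
  y' = encode_pairs (A ++ star i u (live_upto L u m))]].
apply: (@wp_repeat n Inv) => //.
- split=> //; rewrite /upd /= ?live_upto0 ?(good0 gst) ?(good1 gst) ?subn0 ?addn0 //.
    by frame.
  by split; rewrite // cats0 (good_out gst).
- move=> v r' x' y' [sr r6 r7 r8 [r17 -> Ey']].
  have g : good (L, A) r' y by apply: good_same_off sr gst.
  have r3 := good3 g; have rm := good_mark g v; have re := good_edge g u v.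
  (* 4 steps of test, at most 5 of conditional output and 4 of counter updates; the jump of the loop
     makes 14 per vertex. *)
  apply: (@wp_seq _ _ 4 9); apply: wp_block => /=.
  set r1 := upd _ 5 _.
  have sr1 : same_off l r r1 by rewrite /r1; frame.
  have r15E : r1 5 = ~~ (e u v && (v \notin L)).
    rewrite /r1 /upd /= r6 r7 !high_eqF // re rm r3.
    by case: (e u v); case: (v \in _).
  have [r16 r17' r18 r117 r13] : [/\ r1 6 = r' 6, r1 7 = r' 7, r1 8 = r' 8,
    r1 17 = r' 17 & r1 3 = 1] by [].
  have step y1 : y1 = encode_pairs (A ++ star i u (live_upto L u v.+1)) ->
      wp (Block [:: Add 17 17 3; Add 6 6 3; Add 7 7 3; Defs.Sub 8 8 3]) 4
        (fun r' x' y' => Inv v.+1 r' x' y' /\ r' 8 = n - v.+1) r1 x y1.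
    move=> Ey1; apply: wp_block => /=; rewrite /Inv /upd /= r13 r16 r17' r18 r117 r6 r7 r8 r17.
    split; last by lia.
    split; [by frame|lia|lia|lia|by split=> //; lia].
  have [r112 r114] : r1 12 = i /\ r1 14 = u.
    by rewrite !sr1 // (good12 gst) r14.
  apply: (@wp_seq _ _ 5 4); apply: wp_unless; rewrite r15E.
    move=> cond; apply: wp_block => /=; apply: step.
    have {}cond : e u v && (v \notin L) by case: (_ && _) cond.
    rewrite live_uptoS cond Ey' /star map_rcons flatten_rcons catA.
    by rewrite [in RHS]encode_pairs_cat -!cats1 -!catA /= r112 r114 r117 r17.
  move=> cond; apply: step; rewrite live_uptoS Ey'.
  by case: ifP cond => //= ->.
- move=> r' x' y' [sr _ _ _ [_ -> ->]].
  by apply: post; rewrite // -live_upto_all.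
Qed.

(** At this point the output is already that of [B], while marks and index are still those of [L];
    hence [good] is assumed with the old output in place of [y]. *)
Lemma wp_mark L A B (u : 'I_n) r x y (Q : assertion) :
  good (L, A) r (encode_pairs A) -> r 18 = 32 + u -> y = encode_pairs B ->
  (forall r', good (rcons L u, B) r' y ->
     same_off [:: 5; 12; 32 + u] r r' -> Q r' x y) ->
  wp mark_cmd 5 Q r x y.
Proof.
move=> g r18 Ey post; apply: (@wp_seq _ _ 3 2); apply: wp_block => /=.
set r1 := upd _ 5 _.
have sr1 : same_off [:: 5; 12; 32 + u : nat] r r1.
  by rewrite /r1 r18; do ![apply: same_off_upd; first by rewrite !inE eqxx ?orbT].
have [h0 h1 h2 h3 h4 h12 hm he _] := g; rewrite /= in h12 hm he.
have r1m w : r1 (32 + w) = if w == u then 1 else r (32 + w).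
  rewrite /r1 r18 /upd (@high_eqF w 5) // (@high_eqF w 12) // eqn_add2l.
  by rewrite h3.
have r112 : r1 12 = (size L %% k).+1.
  by rewrite /r1 r18 /upd /= h3 h12 addn1.
have r15 : r1 5 = k - (size L %% k).+1.
  by rewrite /r1 r18 /upd /= h2 h3 h12 addn1.
have low a : a < 5 -> r1 a = r a.
  by move=> a5; apply: sr1; rewrite !inE; lia.
have mark (v : 'I_n) : r1 (32 + v) = (v \in rcons L u).
  rewrite r1m mem_rcons inE hm -val_eqE /=; case: eqP => //.
have edge (v w : 'I_n) : r1 (32 + (n + v * n + w)) = e v w.
  (* Matrix cells lie beyond the [n] mark cells, so marking [u] leaves them intact. *)
  by rewrite r1m he; case: eqP => // E; have := ltn_ord u; lia.
have lt_mod : size L %% k < k by rewrite ltn_pmod.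
have modS : (size L).+1 %% k = (size L %% k).+1 %% k.
  by rewrite -addn1 -modnDml addn1.
apply: wp_unless; rewrite r15 => test.
  apply: wp_block => /=; apply: post; last by frame.
  split=> //; rewrite /upd /= ?low //.
  by rewrite size_rcons modS (_ : (size L %% k).+1 = k) ?modnn //; lia.
apply: post => //; split; rewrite /= ?r112 ?low //.
by rewrite size_rcons modS [RHS]modn_small // -subn_gt0.
Qed.

Lemma wp_visit st (u : 'I_n) r x y (Q : assertion) :
  good st r y -> r 14 = u -> r 15 = 32 + (n + u * n) -> r 18 = 32 + u ->
  (forall r' y', good (visit e c k_gt0 st u) r' y' ->
     r' 14 = u.+1 -> r' 15 = 32 + (n + u.+1 * n) -> r' 18 = 32 + u.+1 ->
     r' 16 = r 16 - 1 -> r' 13 = r 13 -> Q r' x y') ->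
  wp visit_cmd (22 * n + 27) Q r x y.
Proof.
case: st => L A g r14 r15 r18 post.
apply: (@wp_leq _ ((4 + n * 8) + (5 + ((4 + n * 14 + 5).+1 + 4)))); first by lia.
apply: wp_seq; apply: (wp_degree g r15) => r1 sr1 r11.
have g1 : good (L, A) r1 y by apply: good_same_off sr1 g.
apply: wp_seq; apply: wp_block => /=; set r2 := upd _ 5 _.
have sr2 : same_off [:: 5; 9; 10] r1 r2 by rewrite /r2; frame.
have g2 : good (L, A) r2 y by apply: good_same_off sr2 g1.
have keep2 a : a \in [:: 13; 14; 15; 16; 18] -> r2 a = r a.
  by move=> al; rewrite sr2 ?sr1 //; rewrite !inE in al *; lia.
(* With [d] the number of live neighbours, X_5 is (1 - d) + (d - c) + mark in truncated subtraction,
   which vanishes iff each term does. *)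
have r25 : (r2 5 == 0) = removable e c L u.
  rewrite /r2 /upd /= (good3 g1) (good4 g1) r11 (sr1 18) // r18.
  rewrite (good_mark g1) /removable /=.
  by case: (u \in L) => /=; lia.
apply: wp_seq.
have last st' r' y' : good st' r' y' -> st' = visit e c k_gt0 (L, A) u ->
    (forall a, a \in [:: 13; 14; 15; 16; 18] -> r' a = r a) ->
    wp (Block [:: Add 14 14 3; Add 18 18 3; Add 15 15 1; Defs.Sub 16 16 3]) 4
       Q r' x y'.
  move=> g' Est keep; rewrite {}Est in g'; apply: wp_block => /=.
  apply: post; rewrite /upd /= ?(good3 g') ?(good1 g') ?keep //; try lia.
  by apply: (@good_same_off [:: 14; 15; 16; 18]) g' => //; frame.
apply: wp_unless => [/eqP|]; rewrite ?lt0n r25 => rem; last first.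
  by apply: last g2 _ keep2; rewrite /= (negPf rem).
apply: wp_seq; apply: (wp_emit (u := u) g2); rewrite ?keep2 //.
move=> r3 y3 sr3 Ey3.
have g3 : good (L, A) r3 y by apply: good_same_off sr3 g2.
rewrite (good_out g2) /= in g3.
apply: (wp_mark (u := u) g3 _ Ey3); first by rewrite sr3 // keep2.
move=> r4 g4 sr4; apply: last g4 _ _; first by rewrite /= rem.
by move=> a al; rewrite sr4 ?sr3 ?keep2 //; rewrite !inE in al *; lia.
Qed.

Lemma wp_pass st r x y (Q : assertion) :
  good st r y ->
  (forall r' y', good (pass e c k_gt0 st) r' y' -> r' 13 = r 13 - 1 -> Q r' x y') ->
  wp pass_cmd (n * (22 * n + 28) + 5) Q r x y.
Proof.
move=> g post.
apply: (@wp_leq _ (4 + (n * (22 * n + 27).+1 + 1))); first by lia.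
apply: wp_seq; apply: wp_block => /=; apply: wp_seq.
pose Inv m r' x' y' := [/\ good (foldl (visit e c k_gt0) st (take m (enum 'I_n))) r' y',
  r' 14 = m, r' 15 = 32 + (n + m * n), r' 18 = 32 + m &
  [/\ r' 16 = n - m, r' 13 = r 13 & x' = x]].
apply: (@wp_repeat n Inv) => //.
- rewrite /Inv take0 /upd /= (good1 g) (good0 g) !addn0 subn0; split=> //.
  by apply: (@good_same_off [:: 14; 15; 16; 18]) g => //; frame.
- move=> u r' x' y' [g' r14 r15 r18 [r16 r13 ->]].
  apply: (wp_visit g' r14 r15 r18) => r2 y2 g2 E14 E15 E18 E16 E13.
  rewrite /Inv take_enum_ordS foldl_rcons; do !split=> //; lia.
- move=> r' x' y' [g' _ _ _ [_ r13 ->]]; apply: wp_block => /=.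
  apply: post; last by rewrite /upd /= r13 (good3 g').
  rewrite take_oversize ?size_enum_ord // in g'.
  by apply: (@good_same_off [:: 13]) g' => //; frame.
Qed.

End Correctness.

(** * Row-major layout of the matrix and the whole program *)

Lemma nth_flatten_rows (T S : Type) (F : T -> seq S) (z : S) t0 m s i j :
  (forall a, size (F a) = m) -> i < size s -> j < m ->
  nth z (flatten [seq F a | a <- s]) (i * m + j) = nth z (F (nth t0 s i)) j.
Proof.
move=> szF + jm; elim: s i => //= a s IHs [_|i /IHs IH]; rewrite nth_cat szF.
  by rewrite jm.
by rewrite mulSn -addnA ltnNge leq_addr /= addKn IH.
Qed.

Lemma size_matrix n (e : rel 'I_n) :
  size [seq nat_of_bool (e u v) | u <- enum 'I_n, v <- enum 'I_n] = n * n.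
Proof. by rewrite size_allpairs size_enum_ord. Qed.

Lemma nth_matrix n (e : rel 'I_n) (u v : 'I_n) :
  nth 0 [seq nat_of_bool (e u v) | u <- enum 'I_n, v <- enum 'I_n] (u * n + v) =
  e u v.
Proof.
rewrite (@nth_flatten_rows _ _ _ _ u) ?size_enum_ord //; last first.
  by move=> w; rewrite size_map size_enum_ord.
by rewrite (nth_map v) ?size_enum_ord // !nth_ord_enum.
Qed.

Lemma wp_greedy n (e : rel 'I_n) c k (k_gt0 : 0 < k) :
  wp (greedy_cmd c) (22 * n ^ 3 + 33 * n ^ 2 + 9 * n + 10)
    (fun _ _ y => y = encode_pairs (greedy e c k_gt0).2)
    (fun=> 0) (encode_instance e k) [::].
Proof.
pose t2 := n * (n * (22 * n + 28) + 5).+1.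
apply: (@wp_leq _ (5 + ((n * n * 5 + n * 3 + 3) + (1 + t2)).+1)).
  by rewrite /t2 !expnS expn0; nia.
apply: wp_seq; apply: wp_block => /=; set r1 := upd _ 5 _.
apply: wp_unless => [r15|]; last first.
  (* For [n = 0] the greedy algorithm makes no pass and the output is empty. *)
  rewrite /r1 /upd /= subn_gt0 ltnS leqn0 => /eqP n0.
  by move: e; rewrite n0 /greedy.
have n_gt0 : 0 < n.
  by move: r15; rewrite /r1 /upd /=; case: (n).
apply: wp_seq; apply: wp_read => //; first exact: size_matrix.
move=> r2 low high; apply: wp_seq; apply: wp_block => /=.
have lowE a : a < 32 -> a \notin [:: 6; 8; 9; 19] -> r2 a = r1 a.
  by move=> lt_a al; apply: low => //; apply: ltn_addr.
(* Registers start at 0 and [read_cmd] spares the mark area, so no vertex is marked yet. *)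
have g2 : good e c ([::] : seq 'I_n, [::] : seq ('I_k * 'I_n)) r2 [::].
  split=> //=; rewrite ?lowE //.
  - by rewrite mod0n.
  - by move=> v; rewrite low ?ltn_add2l // ?inE ?high_eqF //.
  - move=> u v; rewrite -addnA high ?nth_matrix //.
    by have := ltn_ord u; have := ltn_ord v; nia.
pose Inv m r' (x' : seq nat) y' :=
  good e c (iter m (pass e c k_gt0) ([::], [::])) r' y' /\ r' 13 = n - m.
apply: (@wp_repeat n Inv) => //.
- split; last by rewrite /upd /= (good0 g2) (good1 g2) addn0 subn0.
  by apply: (good_same_off (l := [:: 13]) _ _ g2) => //; frame.
- move=> m r' x' y' [g' r13]; apply: wp_pass g' _ => // r3 y3 g3 r313.
  have E : r3 13 = n - m.+1 by rewrite r313 r13; lia.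
  by split.
by move=> r' x' y' [g' _]; apply: good_out g'.
Qed.

(** * Polynomial bound in the size of the input *)

Lemma bitlen_leq_input_size x a : a \in x -> bitlen a <= input_size x.
Proof. by move=> ax; rewrite /input_size (big_rem a) //= leq_addr. Qed.

Lemma size_leq_input_size x : size x <= input_size x.
Proof.
by rewrite /input_size -sum1_size; apply: leq_sum => a _; rewrite /bitlen.
Qed.

Lemma fits_init x b : input_size x <= b -> 0 < b -> fits b (init x).
Proof.
move=> xb b0; split=> /= [i|a /bitlen_leq_input_size ax].
  by rewrite expn_gt0.
by rewrite -bitlen_leq // (leq_trans ax).
Qed.

Lemma const_bits_leq (P : program) i J : onth P i = Some J ->
  const_bits J <= \sum_(J' <- P) const_bits J'.
Proof.
elim: P i => [|J' P IHP] [|i] //=; rewrite big_cons.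
  by case=> ->; apply: leq_addr.
by move/IHP => le; apply: leq_trans le (leq_addl _ _).
Qed.

Theorem mainTheorem4 (c : nat) :
  exists (P : program) (p : {poly nat}),
  forall (n : nat) (e : rel 'I_n) (k : nat),
    simple_graph e -> inductive_graph c e -> 0 < k ->
    exists (t : nat) (y : seq nat) (V : {ffun 'I_k -> {set 'I_n}}),
      [/\ computes P (encode_instance e k) t y,
          t <= (p.[input_size (encode_instance e k)])%R,
          encodes_family V y,
          is_cover e V &
          width V <= c.+1 * OPT e k].
Proof.
pose P := compile 0 (greedy_cmd c).
pose K := \sum_(J <- P) const_bits J.
(* Let X be the input size plus 1. The number of steps is at most 100 X^3, and numbers have at most
   (K + 101) X^3 digits, where [K] depends on [c] alone and bounds the constants of the program;
   twice the product is the polynomial. *)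
exists P, ((200 * (K + 101))%:P * ('X + 1%:P) ^+ 6)%R => n e k [sym_e _] ind_e k_gt0.
set x := encode_instance e k.
(* Every matrix entry takes at least one digit, so [n] is bounded by the input size although numbers
   are measured in binary. *)
have sz_x : n * n + 2 <= input_size x.
  by apply: leq_trans (size_leq_input_size x); rewrite /x /= size_matrix addn2.
have [|m le_m [r [x' [y [Ey run]]]]] := @wp_greedy n e c k k_gt0 P 0.
  by move=> i J.
have [||i J||t runt le_t] := @run_of_iter P (input_size x + K) m (init x).
- by lia.
- by apply: fits_init; lia.
- by move/const_bits_leq; rewrite -/K; lia.
- by rewrite run.
exists t, y, (greedy_cover e c k_gt0); split.
- by exists (iter m (ram_step P) (init x)); last rewrite run.
- apply: leq_trans le_t _.
  rewrite hornerM horner_exp hornerD hornerX !hornerC.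
  rewrite -[(_ * _)%R]/(200 * (K + 101) * ((input_size x + 1) ^ 6)).
  have le_m' : m <= 100 * (input_size x + 1) ^ 3.
    apply: leq_trans le_m _; have le_n : n <= input_size x by nia.
    have := leq_exp2r n (input_size x + 1) (isT : 0 < 3).
    by rewrite !expnS expn0; nia.
  set X := input_size x + 1 in le_m' *.
  have X0 : 0 < X by rewrite /X addn1.
  apply: (@leq_trans (100 * X ^ 3 * ((K + 101) * X ^ 3).*2)).
    apply: leq_mul => //; rewrite leq_double.
    have : X <= X ^ 3 by rewrite -{1}(expn1 X) leq_pexp2l.
    have : 0 < X ^ 3 by rewrite expn_gt0 X0.
    by rewrite /X in le_m' *; nia.
  by rewrite (expnD X 3 3) -muln2; nia.
- exists (greedy e c k_gt0).2; first exact: Ey.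
  by move=> i v; rewrite ffunE inE.
- exact: greedy_is_cover.
- exact: width_greedy_cover.
Qed.
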